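(* For every integer $n\ge 3$ and every integer $d\ge 2$, there exist $k,m\in\mathbb{N}$ with $k\ge m$ such that the ideal of the rough Veronese variety $\mathcal{R}_{d,k,m}$ is not generated in degree $n$, i.e. it is not generated by its elements of degree at most $n$.
   Context: Let $T((\mathbb{R}^d))=\prod_{k\ge 0}(\mathbb{R}^d)^{\otimes k}$ be the algebra of formal power series in non-commuting variables $x_1,\dots,x_d$ (product: tensor/concatenation product), and let $p_k:T((\mathbb{R}^d))\to(\mathbb{R}^d)^{\otimes k}$ be the projection. Let $\mathrm{Lie}(\mathbb{R}^d)$ be the smallest vector subspace containing $x_1,\dots,x_d$ and closed under $[T,S]=TS-ST$, and let $\mathrm{Lie}^m(\mathbb{R}^d)$ be its truncation to tensor orders at most $m$ (regarded inside $T((\mathbb{R}^d))$). Put $\exp(L)=\sum_{n\ge0}L^{\otimes n}/n!$. The rough Veronese variety $\mathcal{R}_{d,k,m}\subset\mathbb{P}^{d^k-1}$ (over $\mathbb{C}$) is the Zariski closure of the image of the composition $\mathrm{Lie}^m(\mathbb{R}^d)\xrightarrow{\exp}T((\mathbb{R}^d))\xrightarrow{p_k}(\mathbb{R}^d)^{\otimes k}\to(\mathbb{C}^d)^{\otimes k}\dashrightarrow\mathbb{P}^{d^k-1}$. A non-empty word $w$ in the alphabet $\{1,\dots,d\}$ is Lyndon if whenever $w=pq$ with $p,q$ nonempty words, $w<q$ in lexicographic order. Let $W_{d,m}$ be the set of Lyndon words of length at most $m$. Let $S=\mathbb{C}[x_w\mid w\in W_{d,m}]$ be graded by giving $x_w$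 weight equal to the length of $w$, let $A$ be the set of monomials of $S$ of weighted degree $k$, and let $R=\mathbb{C}[y_\alpha\mid\alpha\in A]$ with the standard grading. It is known that, after a linear change of coordinates, $\mathcal{R}_{d,k,m}$ lies in the linear subspace $\mathrm{Proj}\,R=\mathbb{P}^{\#A-1}$ of $\mathbb{P}^{d^k-1}$, and its homogeneous prime ideal there is the kernel of the ring homomorphism $R\to S$, $y_\alpha\mapsto\alpha$. ''The ideal of $\mathcal{R}_{d,k,m}$'' means this kernel. *)

(* Defs.v *)
From HB Require Import structures.
From mathcomp Require Import all_boot all_order all_algebra.
From mathcomp Require Import finmap.
From mathcomp Require Import reals.
From mathcomp Require Import complex.
From mathcomp.multinomials Require Import monalg.

Set Implicit Arguments.
Unset Strict Implicit.
Unset Printing Implicit Defensive.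

Import Order.TTheory GRing.Theory.
Local Open Scope ring_scope.

(* Strict lexicographic order on words; a proper prefix of a word is smaller
   than the word. The letters 1, ..., d are represented by 0, ..., d - 1. *)
Definition lex_lt (d : nat) (u v : seq 'I_d) : bool :=
  ((u : seqlexi 'I_d) < (v : seqlexi 'I_d))%O.

Definition lyndon (d : nat) (w : seq 'I_d) : bool :=
  (w != [::]) && all (fun i => lex_lt w (drop i w)) (iota 1 (size w).-1).

Lemma lyndonP (d : nat) (w : seq 'I_d) :
  reflect (w <> [::] /\
           forall p q, p <> [::] -> q <> [::] -> w = p ++ q -> lex_lt w q)
          (lyndon w).
Proof.
apply: (iffP andP) => [[/eqP w0 /allP wL]|[w0 wL]]; split=> //.
- move=> p q p0 q0 def_w.
  have -> : q = drop (size p) w by rewrite def_w drop_size_cat.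
  apply: wL; rewrite mem_iota def_w size_cat.
  by case: p q p0 q0 {def_w} => [|x p] [|y q] //= _ _; rewrite addnS !ltnS leq_addr.
- exact/eqP.
apply/allP => i; rewrite mem_iota => /andP[i0 ilt].
have iw : (i < size w)%N by move: ilt; case: (w) w0 => [|x s] //=; rewrite add1n.
apply: (wL (take i w)); last by rewrite cat_take_drop.
- by move/(congr1 size); rewrite size_takel ?(ltnW iw) //= => i_0; rewrite i_0 in i0.
- by move/(congr1 size)/eqP; rewrite size_drop subn_eq0 leqNgt iw.
Qed.

Definition lyndon_word (d m : nat) : Type :=
  {w : seq 'I_d | lyndon w && (size w <= m)%N}.

Definition weight (d m : nat) (a : {cmonom (lyndon_word d m)}) : nat :=
  (\sum_(w <- finsupp a) a w * size (val w))%N.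

Definition weighted_monom (d k m : nat) : Type :=
  {a : {cmonom (lyndon_word d m)} | weight a == k}.

(* The polynomial rings S = K[x_w | w in W_{d,m}] and R = K[y_a | a in A], with
   W_{d,m} = lyndon_word d m and A = weighted_monom d k m. The monomial a of S
   is << a >>. *)
Notation lyndon_ring K d m := {malg K[{cmonom (lyndon_word d m)}]}.
Notation veronese_ring K d k m := {malg K[{cmonom (weighted_monom d k m)}]}.

Definition monom_eval (I : choiceType) (S : comNzRingType) (h : I -> S)
    (b : {cmonom I}) : S :=
  \prod_(i <- finsupp b) h i ^+ b i.

Lemma monom_eval_mmorphism (I : choiceType) (S : comNzRingType) (h : I -> S) :
  mmorphism (monom_eval h).
Proof.
have evalE (E : {fset I}) (b : {cmonom I}) : (finsupp b `<=` E)%fset ->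
    monom_eval h b = \prod_(i <- E) h i ^+ b i.
  move=> le; rewrite /monom_eval; apply: big_fset_incl le _ => i _.
  by rewrite -cmE_eq0 => /eqP ->; rewrite expr0.
split=> [b1 b2|]; last by rewrite /monom_eval mdom1 big_seq_fset0.
rewrite (evalE (finsupp b1 `|` finsupp b2)%fset) ?mdomD ?fsubset_refl //.
rewrite [monom_eval h b1](evalE _ _ (fsubsetUl _ (finsupp b2))).
rewrite [monom_eval h b2](evalE _ _ (fsubsetUr (finsupp b1) _)).
by rewrite -big_split; apply: eq_bigr => i _; rewrite cmM exprD.
Qed.

HB.instance Definition _ (I : choiceType) (S : comNzRingType) (h : I -> S) :=
  isMultiplicative.Build {cmonom I} S (monom_eval h) (monom_eval_mmorphism h).

(* The K-algebra morphism R -> S mapping the variable y_a to the monomial a. *)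
Definition veronese_map (K : comNzRingType) (d k m : nat) :
    veronese_ring K d k m -> lyndon_ring K d m :=
  mmap (fun c : K => c%:MP)
       (monom_eval (fun a : weighted_monom d k m => << val a >>)).

Definition rough_veronese_ideal (K : comNzRingType) (d k m : nat)
    (p : veronese_ring K d k m) : Prop :=
  veronese_map p = 0.

Definition ideal_gen (T : comNzRingType) (G : T -> Prop) (p : T) : Prop :=
  exists s : seq (T * T),
    (forall c, c \in s -> G c.2) /\ p = \sum_(c <- s) c.1 * c.2.

(* msize q is one more than the total degree of q (and msize 0 = 0). *)
Definition generated_in_degree (K : comNzRingType) (I : choiceType) (n : nat)
    (J : {malg K[{cmonom I}]} -> Prop) : Prop :=
  forall p, J p <-> ideal_gen (fun q => J q /\ (msize q <= n.+1)%N) p.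

(* Main.v *)
Require Import Defs.
From mathcomp Require Import all_boot all_order all_algebra.
From mathcomp Require Import zify ring finmap.
From mathcomp.multinomials Require Import monalg.
From mathcomp Require Import reals.
From mathcomp Require Import complex.

(** The ideal is toric: it is the kernel of a map sending variables to
    monomials, and so it is graded by the monomials of the target.  For such an
    ideal, let b be a monomial such that every divisor e of b of degree at most
    n is the only monomial with its image.  Then the coefficient of e vanishes
    in each element of the ideal, hence the coefficient of b vanishes in each
    element of the ideal generated in degree n.  A single other monomial c with
    the image of b gives the element b - c, which is therefore out of reach
    ([toric_not_generated]).

    Such a b of degree n + 1 comes from a lattice bipyramid.  Put M = n, let
    O, E1, E2 be the points (0,0,0), (1,0,0), (0,1,0) of Z^3, and let the apexes
    be P = (0,0,1) and Q = (1,1,-M).  The only affine relation between the five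
    points is M P + Q = (M-1) O + E1 + E2, of degree M + 1, and their convex
    hull contains no other lattice point.  Describe a point (x,y,z) by the
    values there of the six functions that cut out the facets,
      y,  x,  t = 1-x-y-z,  q = My+z,  r = Mx+z,  v = M-Mx-My-z.
    These are nonnegative exponents, so the five points become monomials
      O = t v^M,  E1 = x r^M,  E2 = y q^M,  P = q r v^(M-1),  Q = x y t^(M-1)
    in six variables, with P^M Q = O^(M-1) E1 E2.

    Three equations single these exponent vectors out among the nonnegative
    integer vectors:
      y+x+t+q+r+v = M+1,   q-r = M(y-x),   v = Mt+(M-1)r-M(M-1)x.
    A single weight encodes all of them at once: the lengths [len] are of the
    form g + cB + e with M << B << g, where c and e are the coefficients of the
    variable on the left of the last two equations when all terms are moved
    there.  Among divisors of P^M Q, the weight (M+1)g then forces each equation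
    separately, as digits to the bases g and B ([blocks_of_weight]).  As there is a Lyndon word 0...0a of each length,
    with a the last letter ([exists_lyndon_word]), k = m = (M+1)g works.

    Comparing exponents of x, y, q, r and t then shows that a proper divisor
    of P^M Q admits no other factorization into blocks ([apex_fiber]). *)

Set Implicit Arguments.
Unset Strict Implicit.
Unset Printing Implicit Defensive.

Import Order.TTheory GRing.Theory Num.Theory.
Local Open Scope nat_scope.

(** * Monomials in finitely many chosen variables *)

Lemma expcmnE (I : choiceType) (m : {cmonom I}) n i : expcmn m n i = n * m i.
Proof.
rewrite /expcmn.
case: n => [|n]; first by rewrite /= onecmE.
by elim: n => [|n IH]; rewrite ?mul1n //= mulcmE -/(iterop n.+1 _ _ _) IH mulSn.
Qed.

Lemma prod_cmE (I : choiceType) (T : Type) (s : seq T) (F : T -> {cmonom I}) i :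
  (\big[mmul/mone]_(a <- s) F a) i = \sum_(a <- s) F a i.
Proof.
by apply: (big_morph (fun m : {cmonom I} => m i)) => [a b|]; rewrite ?cmM ?cm1.
Qed.

Section Power.
Variables (I : choiceType) (n : nat) (X : 'I_n -> I).

Definition supported (m : {cmonom I}) : Prop :=
  forall w, m w != 0 -> exists i, w = X i.

Definition power_monom (c : 'I_n -> nat) : {cmonom I} :=
  \big[mmul/mone]_(i < n) expcmn (ucm (X i)) (c i).

Lemma power_monom_supported c : supported (power_monom c).
Proof.
move=> w; have [/existsP[i /eqP <-]|/existsPn Xw] := boolP [exists i, X i == w].
  by exists i.
rewrite prod_cmE big1 // => i _.
by rewrite expcmnE cmU (negbTE (Xw i)) muln0.
Qed.

Hypothesis X_inj : injective X.

Lemma power_monomE c i : power_monom c (X i) = c i.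
Proof.
rewrite prod_cmE (bigD1 i) //= expcmnE cmUU muln1 big1 ?addn0 // => j ji.
by rewrite expcmnE cmU (inj_eq X_inj) (negbTE ji) muln0.
Qed.

Lemma sum_finsupp_supported (m : {cmonom I}) (f : I -> nat) :
  supported m ->
  \sum_(w <- finsupp m) m w * f w = \sum_(i < n) m (X i) * f (X i).
Proof.
move=> mX; have sub_mX : (finsupp m `<=` [fset X i | i in 'I_n])%fset.
  by apply/fsubsetP => w; rewrite -cmE_neq0 => /mX[i ->]; apply: in_imfset.
rewrite (big_fset_incl _ sub_mX) => [|w _]; last first.
  by rewrite -cmE_neq0 negbK => /eqP ->.
by rewrite big_imfset /= ?big_enum //= => i j _ _; apply: X_inj.
Qed.

Lemma supported_eq (m m' : {cmonom I}) :
  supported m -> supported m' -> (forall i, m (X i) = m' (X i)) -> m = m'.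
Proof.
move=> mX mX' eq_m; apply/eqP/cmP => w.
have [/mX[i ->] //|/negPn/eqP mw0] := boolP (m w != 0).
by have [/mX'[i ->] //|/negPn/eqP ->] := boolP (m' w != 0).
Qed.
End Power.

(** * Toric ideals with a generator of large degree *)

Section Ideal.
Local Open Scope ring_scope.
Variables (J : choiceType) (K : comNzRingType).

(** If the coefficients of all divisors of b vanish on the generators, then the
    coefficient of b vanishes on the ideal, since the coefficient of b in u g is
    a combination of coefficients of divisors of b in g. *)
Lemma mcoeff_ideal_gen (G : {malg K[{cmonom J}]} -> Prop) (b : {cmonom J}) p :
  (forall g u c, G g -> mmul u c = b -> g@_c = 0) -> ideal_gen G p -> p@_b = 0.
Proof.
move=> Gb [s [sG ->]]; rewrite raddf_sum big_seq big1 //= => -[u g] /sG /= Gg.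
rewrite mcoeffMl big1 // => v _; rewrite big1 // => c _.
by case: eqP => // /(Gb _ _ _ Gg) ->; rewrite mulr0.
Qed.

Lemma not_generated_in_degree n (b : {cmonom J})
    (I : {malg K[{cmonom J}]} -> Prop) p :
  I p -> p@_b != 0 ->
  (forall g u c, I g -> mmul u c = b -> (mdeg c <= n)%N -> g@_c = 0) ->
  ~ generated_in_degree n I.
Proof.
move=> Ip pb fib gen; case/eqP: pb; move/gen: Ip.
apply: mcoeff_ideal_gen => g u c [Ig sg] uc.
have [|n_c] := leqP (mdeg c) n; first exact: fib Ig uc.
exact/mcoeff_outdom/mmeasure_mnm_ge/(leq_trans sg n_c).
Qed.
End Ideal.

Section Toric.
Variables (I J : choiceType) (h : J -> {cmonom I}).

Definition toric_monom (b : {cmonom J}) : {cmonom I} :=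
  \big[mmul/mone]_(a <- finsupp b) expcmn (h a) (b a).

Lemma toric_monomE (b : {cmonom J}) i :
  toric_monom b i = \sum_(a <- finsupp b) b a * h a i.
Proof. by rewrite prod_cmE; apply: eq_bigr => a _; rewrite expcmnE. Qed.

Lemma leq_toric_monom (b : {cmonom J}) a i :
  a \in finsupp b -> h a i <= toric_monom b i.
Proof.
move=> ab; rewrite toric_monomE (big_fsetD1 a) //=.
by apply: leq_trans (leq_addr _ _); rewrite leq_pmull // lt0n cmE_neq0.
Qed.

Lemma toric_monomM (b c : {cmonom J}) i :
  toric_monom (mmul b c) i = toric_monom b i + toric_monom c i.
Proof.
have widen (m : {cmonom J}) (E : {fset J}) : (finsupp m `<=` E)%fset ->
    toric_monom m i = \sum_(a <- E) m a * h a i.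
  move=> mE; rewrite toric_monomE (big_fset_incl _ mE) // => a _.
  by rewrite -cmE_eq0 => /eqP ->.
pose D := (finsupp b `|` finsupp c)%fset.
rewrite (widen (mmul b c) D) ?mdomD ?fsubset_refl //.
rewrite (widen b D (fsubsetUl _ _)) (widen c D (fsubsetUr _ _)).
by rewrite -big_split; apply: eq_bigr => a _; rewrite cmM mulnDl.
Qed.

Variable K : comNzRingType.
Local Open Scope ring_scope.

Lemma monom_evalE (b : {cmonom J}) :
  monom_eval (fun a => << h a >> : {malg K[{cmonom I}]}) b =
  << toric_monom b >>.
Proof.
have mulU (x y : {cmonom I}) :
    << x >> * << y >> = << mmul x y >> :> {malg K[{cmonom I}]}.
  by rewrite malgM_def fgmulUU mulr1.
have expU (x : {cmonom I}) n :
    << x >> ^+ n = << expcmn x n >> :> {malg K[{cmonom I}]}.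
  elim: n => [|n IH].
    by rewrite expr0; congr (<< _ >>); apply/eqP/cmP => i; rewrite onecmE.
  rewrite exprS IH mulU; congr (<< _ >>); apply/eqP/cmP => i.
  by rewrite cmM !expcmnE mulSn.
rewrite /monom_eval /toric_monom.
rewrite (big_morph (fun x => << x >> : {malg K[{cmonom I}]})
  (op1 := *%R) (id1 := 1)) //.
exact: eq_bigr.
Qed.

Let toric_map (g : {malg K[{cmonom J}]}) : {malg K[{cmonom I}]} :=
  mmap (fun c : K => c%:MP) (monom_eval (fun a => << h a >>)) g.

Lemma mcoeff_toric_map g (s : {cmonom I}) :
  (toric_map g)@_s = \sum_(b <- msupp g) g@_b *+ (toric_monom b == s).
Proof.
rewrite /toric_map mmapE raddf_sum /=; apply: eq_bigr => b _.
by rewrite monom_evalE mcoeffCM mcoeffU mulrnAr mulr1.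
Qed.

(** In the image of g, the coefficient of the image of b is the sum of the
    coefficients of g over the fiber of b, here a single one. *)
Lemma mcoeff_unique_fiber (b : {cmonom J}) g :
  (forall e, toric_monom e = toric_monom b -> e = b) ->
  toric_map g = 0 -> g@_b = 0.
Proof.
move=> fib g0; case: (msuppP g b) => // bg.
have := mcoeff_toric_map g (toric_monom b).
rewrite g0 mcoeff0 (big_fsetD1 b) //= eqxx mulr1n big1_fset ?addr0 // => e.
rewrite !inE => /andP[eb _] _; case: eqP => [/fib eb'|//].
by rewrite eb' eqxx in eb.
Qed.

Lemma toric_mapB_eq0 (b c : {cmonom J}) :
  toric_monom b = toric_monom c -> toric_map (<< b >> - << c >>) = 0.
Proof.
move=> bc; rewrite /toric_map.
pose f : {additive K -> {malg K[{cmonom I}]}} := @malgC {cmonom I} K.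
pose ev := monom_eval (fun a => << h a >> : {malg K[{cmonom I}]}).
have evU x : mmap f ev << x >> = << toric_monom x >>.
  by rewrite (mmapU (f := f) (h := ev) 1 x) [f _]mpolyC1E mul1r /ev monom_evalE.
have D := mmapB (f := f) (h := ev) << b >> << c >>.
apply: (etrans D); apply: (etrans (congr2 (fun u v => u - v) (evU b) (evU c))).
by rewrite bc subrr.
Qed.

(** When all divisors of b of degree at most n are alone in their fibers, but b
    is not, the binomial b - c is a generator of degree above n. *)
Lemma toric_not_generated n (b c : {cmonom J}) :
  b != c -> toric_monom b = toric_monom c ->
  (forall u e e', mmul u e = b -> (mdeg e <= n)%N ->
     toric_monom e' = toric_monom e -> e' = e) ->
  ~ generated_in_degree n (fun g => toric_map g = 0).
Proof.
move=> bc eq_bc fib.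
apply: (@not_generated_in_degree _ _ n b _ (<< b >> - << c >>)).
- exact: toric_mapB_eq0.
- have coefU x : << x >>@_b = (x == b)%:R :> K by exact: mcoeffU1.
  have coefB := congr2 (fun s t : K => s - t) (coefU b) (coefU c).
  by rewrite mcoeffB coefB eqxx (eq_sym c) (negbTE bc) subr0 oner_eq0.
move=> g u e Ig ue deg_e; apply: mcoeff_unique_fiber Ig => e'.
exact: fib ue deg_e.
Qed.
End Toric.

(** Numerical form of [toric_not_generated].  Only the indices A s can occur in a
    monomial whose image divides that of the monomial of exponents l, so that
    fibers become solution sets of linear equations between exponents. *)
Section Columns.
Variables (I J : choiceType) (h : J -> {cmonom I}).
Variables (r t : nat) (X : 'I_r -> I) (A : 'I_t -> J) (E : 'I_t -> 'I_r -> nat).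
Hypotheses (X_inj : injective X) (A_inj : injective A).
Hypothesis hA : forall s, h (A s) = power_monom X (E s).

Lemma toric_monom_supportedE (e : {cmonom J}) w :
  supported A e ->
  toric_monom h e w = \sum_s e (A s) * power_monom X (E s) w.
Proof.
move=> eA; rewrite toric_monomE (sum_finsupp_supported A_inj (h^~ w) eA).
by apply: eq_bigr => s _; rewrite hA.
Qed.

Lemma toric_monom_supported (e : {cmonom J}) :
  supported A e -> supported X (toric_monom h e).
Proof.
move=> eA w; rewrite toric_monom_supportedE // sum_nat_eq0 => /forallPn[s].
by rewrite /= muln_eq0 negb_or => /andP[_ /power_monom_supported].
Qed.

Lemma toric_monom_column (e : {cmonom J}) i :
  supported A e -> toric_monom h e (X i) = \sum_s e (A s) * E s i.
Proof.
move=> eA; rewrite toric_monom_supportedE //.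
by apply: eq_bigr => s _; rewrite power_monomE.
Qed.

Lemma columns_not_generated (K : comNzRingType) n (l l' : 'I_t -> nat) :
  (forall a, supported X (h a) ->
     (forall i, h a (X i) <= \sum_s l s * E s i) -> exists s, a = A s) ->
  (forall i, \sum_s l s * E s i = \sum_s l' s * E s i) ->
  ~ l =1 l' ->
  (forall c e, (forall s, c s <= l s) -> \sum_s c s <= n ->
     (forall i, \sum_s e s * E s i = \sum_s c s * E s i) -> e =1 c) ->
  ~ generated_in_degree n (fun g : {malg K[{cmonom J}]} =>
      mmap (fun c : K => c%:MP)%R (monom_eval (fun a => << h a >>%R)) g = 0%R).
Proof.
move=> complete eq_ll' neq_ll' fib.
pose b := power_monom A l; pose b' := power_monom A l'.
have bA : supported A b := power_monom_supported (c := l).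
have b'A : supported A b' := power_monom_supported (c := l').
have bE i : toric_monom h b (X i) = \sum_s l s * E s i.
  by rewrite toric_monom_column //; apply: eq_bigr => s _; rewrite power_monomE.
apply: (@toric_not_generated _ _ h K n b b').
- apply/eqP => bb'; apply: neq_ll' => s.
  by rewrite -(power_monomE A_inj l) -/b bb' power_monomE.
- apply: (supported_eq (X := X)) => [||i]; try exact: toric_monom_supported.
  rewrite bE eq_ll' toric_monom_column //.
  by apply: eq_bigr => s _; rewrite power_monomE.
move=> u c e uc deg_c ec.
have cb a : c a <= b a by rewrite -uc cmM leq_addl.
have cA : supported A c.
  by move=> a; rewrite -lt0n => ca; apply: bA; rewrite -lt0n (leq_trans ca).
have eA : supported A e.
  move=> a ea; have ab w : h a w <= toric_monom h b w.
    rewrite -uc toric_monomM -ec.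
    by apply: leq_trans (leq_addl _ _); rewrite leq_toric_monom // -cmE_neq0.
  apply: complete => [w|i]; last by rewrite -bE.
  rewrite -lt0n => aw; apply: (toric_monom_supported bA).
  by rewrite -lt0n (leq_trans aw).
apply: (supported_eq eA cA); apply: fib => [s||i].
- by rewrite -(power_monomE A_inj l).
- suff -> : \sum_s c (A s) = mdeg c by [].
  transitivity (\sum_s c (A s) * 1).
    by apply: eq_bigr => s _; rewrite muln1.
  rewrite -(sum_finsupp_supported A_inj (fun=> 1) cA).
  by apply: eq_bigr => a _; rewrite muln1.
- have := congr1 (fun m : {cmonom I} => m (X i)) ec.
  by rewrite !toric_monom_column.
Qed.
End Columns.

(** * Lyndon words of every length *)

Lemma lex_lt_zeros (d a c : nat) : c < a ->
  lex_lt (rcons (nseq a ord0) ord_max) (rcons (nseq c (ord0 : 'I_d.+2)) ord_max).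
Proof.
by elim: c a => [|c IH] [|a] //; rewrite /lex_lt /= ltxi_cons ?lexx /= => /IH.
Qed.

(** In the word 0...0a, each proper suffix has fewer leading zeros, hence is
    larger. *)
Lemma exists_lyndon_word (d m l : nat) :
  0 < l <= m -> exists w : lyndon_word d.+2 m, size (val w) = l.
Proof.
case: l => [|l] //= lm; pose w := rcons (nseq l (ord0 : 'I_d.+2)) ord_max.
have sw : size w = l.+1 by rewrite size_rcons size_nseq.
suff wP : lyndon w && (size w <= m) by exists (exist _ w wP).
rewrite sw lm andbT; apply/lyndonP; split=> [|u v u0 v0 w_uv].
  by move/(congr1 size); rewrite sw.
have su : 0 < size u <= l.
  have := congr1 size w_uv; rewrite sw size_cat.
  by case: u v u0 v0 {w_uv} => [|? ?] [|? ?] //= _ _; lia.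
have -> : v = rcons (nseq (l - size u) ord0) ord_max.
  have -> : v = drop (size u) w by rewrite w_uv drop_size_cat.
  rewrite drop_rcons ?size_nseq; last by case/andP: su.
  by rewrite drop_nseq.
by apply: lex_lt_zeros; lia.
Qed.

(** * Five blocks in six variables *)

Lemma sum_ord5 (F : 'I_5 -> nat) : \sum_(s < 5) F s =
  F (@Ordinal 5 0 isT) + F (@Ordinal 5 1 isT) + F (@Ordinal 5 2 isT) +
  F (@Ordinal 5 3 isT) + F (@Ordinal 5 4 isT).
Proof.
rewrite !big_ord_recl big_ord0 addn0 !addnA.
by do ?congr (_ + _); congr F; apply: val_inj.
Qed.

Lemma sum_ord6 (F : 'I_6 -> nat) : \sum_(i < 6) F i =
  F (@Ordinal 6 0 isT) + F (@Ordinal 6 1 isT) + F (@Ordinal 6 2 isT) +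
  F (@Ordinal 6 3 isT) + F (@Ordinal 6 4 isT) + F (@Ordinal 6 5 isT).
Proof.
rewrite !big_ord_recl big_ord0 addn0 !addnA.
by do ?congr (_ + _); congr F; apply: val_inj.
Qed.

Lemma forall_ord5 (F : 'I_5 -> Prop) :
  F (@Ordinal 5 0 isT) -> F (@Ordinal 5 1 isT) -> F (@Ordinal 5 2 isT) ->
  F (@Ordinal 5 3 isT) -> F (@Ordinal 5 4 isT) -> forall s, F s.
Proof.
move=> F0 F1 F2 F3 F4.
have E (s t : 'I_5) : val s = val t -> F s -> F t by move/val_inj->.
case=> [[|[|[|[|[|s]]]]] ?] //;
  [exact: E F0 | exact: E F1 | exact: E F2 | exact: E F3 | exact: E F4].
Qed.

Lemma forall_ord6 (F : 'I_6 -> Prop) :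
  F (@Ordinal 6 0 isT) -> F (@Ordinal 6 1 isT) -> F (@Ordinal 6 2 isT) ->
  F (@Ordinal 6 3 isT) -> F (@Ordinal 6 4 isT) -> F (@Ordinal 6 5 isT) ->
  forall i, F i.
Proof.
move=> F0 F1 F2 F3 F4 F5.
have E (i j : 'I_6) : val i = val j -> F i -> F j by move/val_inj->.
case=> [[|[|[|[|[|[|i]]]]]] ?] //; [exact: E F0 | exact: E F1 | exact: E F2
  | exact: E F3 | exact: E F4 | exact: E F5].
Qed.

(** The exponents of y, x, t, q, r, v in O, E1, E2, P, Q, with M = p + 1. *)
Definition block_rows (p : nat) : seq (seq nat) :=
  [:: [:: 0; 0; 1; 0; 0; p.+1];
      [:: 0; 1; 0; 0; p.+1; 0];
      [:: 1; 0; 0; p.+1; 0; 0];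
      [:: 0; 0; 0; 1; 1; p];
      [:: 1; 1; p; 0; 0; 0] ].

Definition block (p : nat) (s : 'I_5) (i : 'I_6) : nat :=
  nth 0 (nth [::] (block_rows p) s) i.

(** P^M Q and O^(M-1) E1 E2. *)
Definition apex_side (p : nat) (s : 'I_5) : nat :=
  nth 0 [:: 0; 0; 0; p.+1; 1] s.
Definition base_side (p : nat) (s : 'I_5) : nat :=
  nth 0 [:: p; 1; 1; 0; 0] s.

Lemma block_inj p s s' : block p s =1 block p s' -> s = s'.
Proof.
move=> eq_b; have := eq_b (@Ordinal 6 0 isT).
have := eq_b (@Ordinal 6 1 isT); have := eq_b (@Ordinal 6 3 isT).
by move: s s' {eq_b}; apply: forall_ord5; apply: forall_ord5; rewrite /block /=.
Qed.

Lemma apex_base_eq p i :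
  \sum_s apex_side p s * block p s i = \sum_s base_side p s * block p s i.
Proof.
rewrite !sum_ord5; move: i; apply: forall_ord6.
all: by rewrite /apex_side /base_side /block /=; lia.
Qed.

(** If e uses E1 or E2, then its exponent of x or y is positive, so c contains
    Q, and its exponent of r or q is at least M, so c contains P^M: then c is
    the whole of P^M Q, of degree M + 1.  Otherwise x counts the factors Q, q counts
    the factors P, and t excludes O. *)
Lemma apex_fiber p (c e : 'I_5 -> nat) :
  (forall s, c s <= apex_side p s) -> \sum_s c s <= p.+1 ->
  (forall i, \sum_s e s * block p s i = \sum_s c s * block p s i) ->
  e =1 c.
Proof.
move=> cb; rewrite sum_ord5 => c_deg eq_ec.
have := cb (@Ordinal 5 0 isT); have := cb (@Ordinal 5 1 isT).
have := cb (@Ordinal 5 2 isT); have := cb (@Ordinal 5 3 isT).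
have := cb (@Ordinal 5 4 isT); move: c_deg.
have := eq_ec (@Ordinal 6 0 isT); have := eq_ec (@Ordinal 6 1 isT).
have := eq_ec (@Ordinal 6 2 isT); have := eq_ec (@Ordinal 6 3 isT).
have := eq_ec (@Ordinal 6 4 isT); rewrite !sum_ord5 /apex_side /block /=.
set eO := e _; set eE1 := e _; set eE2 := e _; set eP := e _; set eQ := e _.
set cO := c _; set cE1 := c _; set cE2 := c _; set cP := c _; set cQ := c _.
move=> Er Eq Et Ex Ey deg cQb cPb cE2b cE1b cOb.
have cO0 : cO = 0 by lia.
have cE10 : cE1 = 0 by lia.
have cE20 : cE2 = 0 by lia.
move: Er Eq Et Ex Ey deg; rewrite cO0 cE10 cE20 => Er Eq Et Ex Ey deg.
have eE10 : eE1 = 0.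
  have [//|eE1_gt0] := posnP eE1.
  by have := leq_pmull p.+1 eE1_gt0; lia.
have eE20 : eE2 = 0 by lia.
have eQ_c : eQ = cQ by lia.
have eP_c : eP = cP by move: Eq; rewrite eE20; lia.
have eO0 : eO = 0 by move: Et; rewrite eQ_c; lia.
apply: forall_ord5; [exact: etrans eO0 (esym cO0) | exact: etrans eE10 (esym cE10)
  | exact: etrans eE20 (esym cE20) | exact: eP_c | exact: eQ_c].
Qed.

(** The five points are the lattice points (x, y, z) of the bipyramid, with
    z = r - Mx: for each choice of x and y in {0, 1}, the equations determine
    t + r, and nonnegativity leaves a single solution, or two if x = y = 0. *)
Lemma blocks_of_equations p y x t q r v :
  y <= 1 -> x <= 1 ->
  y + x + t + q + r + v = p.+2 ->
  q + p.+1 * x = r + p.+1 * y ->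
  v + p.+1 * p * x = p.+1 * t + p * r ->
  [:: y; x; t; q; r; v] \in block_rows p.
Proof.
move=> y1 x1 deg eq_q eq_v.
have cancel (a b : nat) : p.+2 * a = p.+2 * b -> a = b.
  by move/eqP; rewrite eqn_pmul2l // => /eqP.
suff [s s5 <-] : exists2 s, s < 5 & nth [::] (block_rows p) s = [:: y; x; t; q; r; v].
  exact: mem_nth.
case: y y1 deg eq_q => [|[|]] // _; case: x x1 eq_v => [|[|]] // _ eq_v deg eq_q.
- have /cancel tr : p.+2 * (t + r) = p.+2 * 1 by lia.
  have [t1|t0] : t = 1 \/ t = 0 by lia.
    by exists 0 => //=; congr [:: _; _; _; _; _; _]; lia.
  by exists 3 => //=; congr [:: _; _; _; _; _; _]; lia.
- have /cancel tr : p.+2 * (t + r) = p.+2 * p.+1 by lia.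
  by exists 1 => //=; congr [:: _; _; _; _; _; _]; lia.
- have /cancel tr : p.+2 * (t + r) = p.+2 * 0 by lia.
  by exists 2 => //=; congr [:: _; _; _; _; _; _]; lia.
- have /cancel tr : p.+2 * (t + r) = p.+2 * p by lia.
  by exists 4 => //=; congr [:: _; _; _; _; _; _]; lia.
Qed.

(** * Lengths that force the five blocks *)

Local Open Scope ring_scope.

(** A multiple of a number a that is smaller than a vanishes; this applies first
    to a = g, then to a = B. *)
Lemma digits_uniq (g B D D0 c e : int) :
  `|e| < B -> `|c * B + e| < g -> D * g + (c * B + e) = D0 * g ->
  [/\ D = D0, c = 0 & e = 0].
Proof.
have multiple_small (u a b : int) : `|u| < a -> b * a + u = 0 -> b = 0.
  move=> ua bau; apply/eqP; rewrite -normr_eq0; apply/negPn/negP => b0.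
  have b1 : 1 <= `|b| by lia.
  have : `|b| * a = `|u|.
    have a0 : 0 <= a by lia.
    by rewrite -[a in LHS]ger0_norm // -normrM (_ : b * a = - u) ?normrN //; lia.
  by have := ler_wpM2r (_ : 0 <= a) b1; rewrite mul1r => /(_ ltac:(lia)); lia.
move=> eB ceg eq_g.
have D_D0 : D - D0 = 0 by apply: (multiple_small (c * B + e) g) => //; lia.
have ce0 : c * B + e = 0.
  by move: eq_g; rewrite (_ : D = D0); lia.
have c0 := multiple_small e B c eB ce0.
by split; [lia | | move: ce0; rewrite c0 mul0r add0r].
Qed.

Local Close Scope ring_scope.

(** B and g, the inner and the outer base; g is also the mean length of the
    M + 1 factors of a block. *)
Definition radix (p : nat) : nat := 2 * p.+1 * p.+1.
Definition mean_len (p : nat) : nat := 3 * p.+1 * radix p.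

Definition len (p : nat) (i : 'I_6) : nat :=
  let g := mean_len p in let B := radix p in
  nth 0 [:: g - p.+1 * B; g + p.+1 * p + p.+1 * B; g - p.+1;
            g + B; g - B - p; g + 1] i.

(** The last two bounds exclude carries: for exponents bounded by those of
    P^M Q, the digit e is at most 2 M (M-1) and the digit c at most 2 M in
    absolute value. *)
Lemma radix_bounds p : 0 < p ->
  [/\ p.+1 <= radix p, 2 * radix p <= p.+1 * radix p, 2 * p.+1 * p < radix p
    & 2 * p.+1 * radix p + 2 * p.+1 * p < mean_len p].
Proof. by rewrite /mean_len /radix => p0; split; nia. Qed.

Lemma len_bounds p i : 0 < p -> 0 < len p i <= p.+2 * mean_len p.
Proof.
move=> p0; have [MB BB Bbig gbig] := radix_bounds p0.
by move: i; apply: forall_ord6; rewrite /len /=; lia.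
Qed.

Lemma len_inj p : 0 < p -> injective (len p).
Proof.
move=> p0 i j; have [MB BB Bbig gbig] := radix_bounds p0.
move: i j; apply: forall_ord6; apply: forall_ord6; rewrite /len //=; lia.
Qed.

Lemma block_weight p s : 0 < p -> \sum_i block p s i * len p i = p.+2 * mean_len p.
Proof.
move=> p0; have [MB BB Bbig gbig] := radix_bounds p0.
by rewrite sum_ord6; move: s; apply: forall_ord5; rewrite /block /len /=; nia.
Qed.

(** The weight is D g + (c B + e), where D is the degree, and c and e vanish
    exactly when the other two equations hold. *)
Lemma equations_of_weight p y x t q r v : 0 < p ->
  y <= 1 -> x <= 1 -> t <= p -> q <= p.+1 -> r <= p.+1 -> v <= p.+1 * p ->
  \sum_(i < 6) nth 0 [:: y; x; t; q; r; v] i * len p i = p.+2 * mean_len p ->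
  [/\ y + x + t + q + r + v = p.+2,
      q + p.+1 * x = r + p.+1 * y &
      v + p.+1 * p * x = p.+1 * t + p * r].
Proof.
move=> p0 y1 x1 tp qp rp vp; have [MB _ Bbig gbig] := radix_bounds p0.
rewrite sum_ord6 /len /=.
move: (mean_len p) (radix p) MB Bbig gbig => g B MB Bbig gbig wt_eq.
pose c : int := (q%:Z - r%:Z + p.+1%:Z * (x%:Z - y%:Z))%R.
pose e : int :=
  (v%:Z - p.+1%:Z * t%:Z - p%:Z * r%:Z + p.+1%:Z * p%:Z * x%:Z)%R.
have Mt : p.+1 * t <= p.+1 * p by rewrite leq_mul2l tp orbT.
have pr : p * r <= p.+1 * p by rewrite [p.+1 * p]mulnC leq_mul2l rp orbT.
have Mpx : p.+1 * p * x <= p.+1 * p by rewrite -[leqRHS]muln1 leq_mul2l x1 orbT.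
have Mx : p.+1 * x <= p.+1 by rewrite -[leqRHS]muln1 leq_mul2l x1.
have My : p.+1 * y <= p.+1 by rewrite -[leqRHS]muln1 leq_mul2l y1.
have eb : (`|e| <= 2 * (p.+1 * p)%:Z)%R by rewrite /e; lia.
have cb : (`|c| <= 2 * p.+1%:Z)%R by rewrite /c; lia.
have ceb : (`|c * B%:Z + e| < g%:Z)%R.
  have : (`|c * B%:Z| <= 2 * p.+1%:Z * B%:Z)%R.
    by rewrite normrM; apply: ler_pM; lia.
  lia.
have wtZ :
  ((y + x + t + q + r + v)%:Z * g%:Z + (c * B%:Z + e) = p.+2%:Z * g%:Z)%R.
  rewrite -[RHS]PoszM -wt_eq /c /e !PoszD !PoszM.
  have -> : Posz (g - p.+1 * B) = (g%:Z - p.+1%:Z * B%:Z)%R by lia.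
  have -> : Posz (g - p.+1) = (g%:Z - p.+1%:Z)%R by lia.
  have -> : Posz (g - B - p) = (g%:Z - B%:Z - p%:Z)%R by lia.
  by ring.
have /digits_uniq : (`|e| < B%:Z)%R by lia.
move=> /(_ _ _ _ _ ceb wtZ) [/eqP]; rewrite eqz_nat => /eqP deg c0 e0.
by split=> //; move: c0 e0; rewrite /c /e; lia.
Qed.

Lemma blocks_of_weight p (m : 'I_6 -> nat) : 0 < p ->
  (forall i, m i <= \sum_s apex_side p s * block p s i) ->
  \sum_i m i * len p i = p.+2 * mean_len p ->
  exists s, m =1 block p s.
Proof.
move=> p0 mb wt.
pose row := [:: m (@Ordinal 6 0 isT); m (@Ordinal 6 1 isT); m (@Ordinal 6 2 isT);
                m (@Ordinal 6 3 isT); m (@Ordinal 6 4 isT); m (@Ordinal 6 5 isT)].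
have mE i : m i = nth 0 row i by move: i; apply: forall_ord6.
have wt_row : \sum_(i < 6) nth 0 row i * len p i = p.+2 * mean_len p.
  by rewrite -wt; apply: eq_bigr => i _; rewrite -mE.
have := mb (@Ordinal 6 0 isT); have := mb (@Ordinal 6 1 isT).
have := mb (@Ordinal 6 2 isT); have := mb (@Ordinal 6 3 isT).
have := mb (@Ordinal 6 4 isT); have := mb (@Ordinal 6 5 isT).
rewrite !sum_ord5 /apex_side /block /= !(mul0n, muln0, add0n, addn0, mul1n, muln1).
move=> vb rb qb tb xb yb.
have [deg eq_q eq_v] := equations_of_weight p0 yb xb tb qb rb vb wt_row.
have /(nthP [::])[s s5 row_s] := blocks_of_equations yb xb deg eq_q eq_v.
by exists (Ordinal s5) => i; rewrite mE /block row_s.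
Qed.

Theorem proposition2p9 (R : realType) (n d : nat) (hn : (3 <= n)%N) (hd : (2 <= d)%N) :
  exists k m : nat, (0 < m <= k)%N /\
    ~ generated_in_degree n (@rough_veronese_ideal R[i] d k m).
Proof.
case: d hd => [|[|d]] // _; case: n hn => [|p] // p2.
have p0 : 0 < p by lia.
(* M = n = p + 1; no length exceeds k, so that m = k admits the six words. *)
pose k := p.+2 * mean_len p; exists k, k.
split; first by have := len_bounds ord0 p0; rewrite -/k; lia.
pose word := lyndon_word d.+2 k; pose column := weighted_monom d.+2 k k.
have [X sizeX] : exists X : 'I_6 -> word, forall i, size (val (X i)) = len p i.
  apply: (fin_all_exists (P := fun i (w : word) => size (val w) = len p i)) => i.
  by apply: exists_lyndon_word; apply: len_bounds.
have X_inj : injective X.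
  by move=> i j ij; apply: (len_inj p0); rewrite -!sizeX ij.
have weightE (a : {cmonom (lyndon_word d.+2 k)}) :
    supported X a -> weight a = \sum_i a (X i) * len p i.
  move=> aX; rewrite /weight.
  rewrite (sum_finsupp_supported X_inj (fun w => size (val w)) aX).
  by apply: eq_bigr => i _; rewrite sizeX.
have [A valA] : exists A : 'I_5 -> column,
    forall s, val (A s) = power_monom X (block p s).
  apply: (fin_all_exists
    (P := fun s (a : column) => val a = power_monom X (block p s))) => s.
  suff wP : weight (power_monom X (block p s)) == k.
    by exists (exist (fun a => weight a == k) _ wP).
  apply/eqP; rewrite weightE; last exact: power_monom_supported.
  apply: etrans (block_weight s p0).
  by apply: eq_bigr => i _; rewrite power_monomE.
have A_inj : injective A.
  move=> s t st; apply: (@block_inj p) => i.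
  by rewrite -(power_monomE X_inj (block p s)) -valA st valA power_monomE.
apply: (columns_not_generated X_inj A_inj valA
  (l := apex_side p) (l' := base_side p)).
- move=> a aX ab.
  have [//||s as_] := @blocks_of_weight p (fun i => val a (X i)) p0.
    by rewrite -weightE //; apply/eqP/(valP a).
  exists s; apply: val_inj; rewrite valA.
  apply: supported_eq aX (power_monom_supported (c := _)) _ => i.
  by rewrite power_monomE.
- exact: apex_base_eq.
- by move/(_ (@Ordinal 5 4 isT)).
- exact: apex_fiber.
Qed.
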